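(* Let $A\in M_{n,n}(\mathbb{R})$, let $A^{T}$ denote its transpose, and let $A_S=\frac12(A+A^{T})$ and $A_{AS}=\frac12(A-A^{T})$. Then the sum of all principal minors of order two of $A$ equals the sum of all principal minors of order two of $A_S$ plus the sum of all principal minors of order two of $A_{AS}$. Similarly, the sum of all principal permanents of order two of $A$ equals the sum of all principal permanents of order two of $A_S$ plus the sum of all principal permanents of order two of $A_{AS}$.
   Context: $M_{n,n}(\mathbb{R})$ is the set of real $n\times n$ matrices. A principal minor (resp. principal permanent) of order two of a matrix is the determinant (resp. permanent) of the $2\times2$ submatrix formed by rows and columns $i,j$, for some $1\le i<j\le n$. *)

(* Defs.v *)
(* The real numbers are rendered as an arbitrary realType: a complete archimedean
   ordered field. *)
From mathcomp Require Import all_boot all_order all_algebra perm.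
From mathcomp Require Import reals.

Set Implicit Arguments.
Unset Strict Implicit.
Unset Printing Implicit Defensive.

Import GRing.Theory.
Local Open Scope ring_scope.

Definition permanent (R : comPzRingType) (n : nat) (A : 'M[R]_n) : R :=
  \sum_(s : 'S_n) \prod_(i < n) A i (s i).

Definition principal_submx2 (R : comPzRingType) (n : nat) (A : 'M[R]_n)
    (i j : 'I_n) : 'M[R]_2 :=
  mxsub (tnth [tuple i; j]) (tnth [tuple i; j]) A.

Definition sum_principal_minors2 (R : comPzRingType) (n : nat)
    (A : 'M[R]_n) : R :=
  \sum_(i < n) \sum_(j < n | (i < j)%N) \det (principal_submx2 A i j).

Definition sum_principal_permanents2 (R : comPzRingType) (n : nat)
    (A : 'M[R]_n) : R :=
  \sum_(i < n) \sum_(j < n | (i < j)%N) permanent (principal_submx2 A i j).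

Definition sym_part (R : realType) (n : nat) (A : 'M[R]_n) : 'M[R]_n :=
  2^-1 *: (A + A^T).

Definition antisym_part (R : realType) (n : nat) (A : 'M[R]_n) : 'M[R]_n :=
  2^-1 *: (A - A^T).

(* Main.v *)
Require Import Defs.
From mathcomp Require Import all_boot all_order all_algebra.
From mathcomp Require Import reals.
From mathcomp Require Import perm ring.
Local Open Scope ring_scope.

(** The identities already hold for each pair [i], [j] separately. Put s = (a_ij + a_ji)/2 and d =
    (a_ij - a_ji)/2. The symmetric part keeps the diagonal and has s twice off it; the antisymmetric
    part has zero diagonal and off-diagonal entries d, -d. Both claims then reduce to s^2 - d^2 =
    a_ij a_ji, once [det_mx22] and [permanent_mx22] expand the 2x2 blocks. *)

Lemma ord2P (i : 'I_2) : i = 0 \/ i = 1.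
Proof. by case: i => [[|[|//]] ?]; [left|right]; apply: val_inj. Qed.

Lemma perm_ord2 (s : 'S_2) : s = 1%g \/ s = tperm 0 1.
Proof.
have /eqP s01 : s 0 != s 1 by rewrite (inj_eq perm_inj).
have [s0|s0] := ord2P (s 0); have [s1|s1] := ord2P (s 1); try congruence;
  [left|right]; apply/permP => i; have [->|->] := ord2P i;
  by rewrite ?perm1 ?tpermL ?tpermR.
Qed.

(** Shared by determinant and permanent, which differ only in the sign attached to the
    transposition. *)
Lemma sum_perm_ord2 (V : nmodType) (F : 'S_2 -> V) :
  \sum_(s : 'S_2) F s = F 1%g + F (tperm 0 1).
Proof.
rewrite (bigD1 (1%g : 'S_2)) //= (bigD1 (tperm 0 1)) /=; last first.
  by apply/eqP => /permP/(_ 0); rewrite tpermL perm1.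
rewrite big1 ?GRing.addr0 // => s /andP[s1 s2].
by case: (perm_ord2 s) s1 s2 => ->; rewrite eqxx.
Qed.

Lemma prod_ord2 (R : pzSemiRingType) (F : 'I_2 -> R) :
  \prod_(i < 2) F i = F 0 * F 1.
Proof.
rewrite !big_ord_recl big_ord0 GRing.mulr1.
(* [big_ord_recl] produces the second index as a [lift], equal to [1] only through its value. *)
by congr (_ * F _); apply: val_inj.
Qed.

Lemma det_mx22 (R : comPzRingType) (M : 'M[R]_2) :
  \det M = M 0 0 * M 1 1 - M 0 1 * M 1 0.
Proof.
rewrite /determinant sum_perm_ord2 !prod_ord2 odd_perm1 odd_tperm.
by rewrite !perm1 tpermL tpermR GRing.expr0 GRing.expr1 GRing.mul1r GRing.mulN1r.
Qed.

Lemma permanent_mx22 (R : comPzRingType) (M : 'M[R]_2) :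
  permanent M = M 0 0 * M 1 1 + M 0 1 * M 1 0.
Proof. by rewrite /permanent sum_perm_ord2 !prod_ord2 !perm1 tpermL tpermR. Qed.

Theorem theorem10 (R : realType) (n : nat) (A : 'M[R]_n) :
  sum_principal_minors2 A =
    sum_principal_minors2 (sym_part A) + sum_principal_minors2 (antisym_part A)
  /\
  sum_principal_permanents2 A =
    sum_principal_permanents2 (sym_part A)
    + sum_principal_permanents2 (antisym_part A).
Proof.
split; rewrite -big_split; apply: eq_bigr => i _ /=;
  rewrite -big_split; apply: eq_bigr => j _ /=.
(* The default [i] of [tnth_nth] is never reached: it only lets the tuple lookups compute to [i] and
   [j]. [field] then clears the halves. *)
- by rewrite !det_mx22 !mxE /= !(tnth_nth i) /=; field.
- by rewrite !permanent_mx22 !mxE /= !(tnth_nth i) /=; field.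
Qed.
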